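(* For all rational numbers $n_1,n_2$, define $$\begin{aligned} x_1&=-4n_1(n_1-n_2)(n_1+n_2)(n_1^2-3n_1n_2+n_2^2),\\ x_2&=-4n_1(n_1^4-4n_1^3n_2+5n_1^2n_2^2-n_2^4),\\ x_3&=4(n_1^2-n_1n_2+n_2^2)(n_1^3-3n_1^2n_2+n_2^3),\\ x_4&=-4n_2(n_1^4-4n_1^3n_2+n_1^2n_2^2+2n_1n_2^3-n_2^4),\\ x_5&=-4n_1n_2(n_1-2n_2)(n_1^2+n_1n_2-n_2^2),\\ x_6&=4(n_1-n_2)(n_1^4-2n_1^3n_2-n_1^2n_2^2+n_2^4),\\ x_7&=4n_2(2n_1-n_2)(n_1-n_2)(n_1^2-n_1n_2-n_2^2), \end{aligned}$$ and $y_i=-x_i$ for $i=1,\dots,7$. Then $$\sum_{i=1}^7x_i^r=\sum_{i=1}^7y_i^r\qquad\text{for } r=1,2,3,4,5,6.$$ Moreover, as a parametric solution this is nontrivial: in $\mathbb{Q}[n_1,n_2]$ the multisets $\{x_1,\dots,x_7\}$ and $\{y_1,\dots,y_7\}$ are distinct.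
   Context: An ideal solution of the Tarry-Escott problem of degree $k$ consists of two distinct multisets $\{x_1,\dots,x_{k+1}\}$, $\{y_1,\dots,y_{k+1}\}$ with $\sum x_i^r=\sum y_i^r$ for $r=1,\dots,k$. *)

(* Defs.v *)
(* MathComp; polynomials in two variables come from multinomials. *)
From mathcomp Require Import all_boot all_order all_algebra.
From mathcomp Require Import mpoly.

Set Implicit Arguments.
Unset Strict Implicit.
Unset Printing Implicit Defensive.

Import GRing.Theory.
Local Open Scope ring_scope.

(* The ring is a parameter so that the same formulas are read both at rational
   numbers and at the two indeterminates of Q[n1, n2].
   The tuple positions 0, ..., 6 hold x_1, ..., x_7. *)
Definition pte_x (R : comNzRingType) (n1 n2 : R) : 7.-tuple R :=
  [tuple
    - 4 * n1 * (n1 - n2) * (n1 + n2) * (n1 ^+ 2 - 3 * n1 * n2 + n2 ^+ 2);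
    - 4 * n1 * (n1 ^+ 4 - 4 * n1 ^+ 3 * n2 + 5 * n1 ^+ 2 * n2 ^+ 2 - n2 ^+ 4);
    4 * (n1 ^+ 2 - n1 * n2 + n2 ^+ 2) * (n1 ^+ 3 - 3 * n1 ^+ 2 * n2 + n2 ^+ 3);
    - 4 * n2 * (n1 ^+ 4 - 4 * n1 ^+ 3 * n2 + n1 ^+ 2 * n2 ^+ 2
                + 2 * n1 * n2 ^+ 3 - n2 ^+ 4);
    - 4 * n1 * n2 * (n1 - 2 * n2) * (n1 ^+ 2 + n1 * n2 - n2 ^+ 2);
    4 * (n1 - n2) * (n1 ^+ 4 - 2 * n1 ^+ 3 * n2 - n1 ^+ 2 * n2 ^+ 2 + n2 ^+ 4);
    4 * n2 * (2 * n1 - n2) * (n1 - n2) * (n1 ^+ 2 - n1 * n2 - n2 ^+ 2)].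

Definition pte_y (R : comNzRingType) (n1 n2 : R) : 7.-tuple R :=
  [tuple - tnth (pte_x n1 n2) i | i < 7].

(* Main.v *)
(* Since y = -x, even power sums agree trivially, and for odd r the claim is the
   polynomial identity x_1^r + ... + x_7^r = 0.  If the two multisets agreed in
   Q[n1, n2], they would agree after every specialization; but at
   (n1, n2) = (1, 3) the x_i are 32, 188, 532, 348, -300, -536, -264, and -32 is
   not among them. *)
Require Import Defs.
From mathcomp Require Import all_boot all_order all_algebra.
From mathcomp Require Import mpoly.
From mathcomp Require Import ring.

Import GRing.Theory.
Local Open Scope ring_scope.

Lemma sum_pte_x_odd (R : comNzRingType) (a b : R) (r : nat) :
  odd r -> (r <= 6)%N -> \sum_(i < 7) tnth (pte_x a b) i ^+ r = 0.
Proof.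
move=> r_odd r_le6.
(* With a numeral as exponent, each case is a polynomial identity within reach of [ring]. *)
have {r_odd r_le6} : r \in [:: 1; 3; 5]%N by case: r r_odd r_le6; do 6?case.
rewrite !inE !big_ord_recl big_ord0 !(tnth_nth 0) /= => /or3P[] /eqP->; ring.
Qed.

Lemma pte_yE (R : comNzRingType) (a b : R) :
  pte_y a b = [seq - x | x <- pte_x a b] :> seq R.
Proof. by rewrite -[in RHS](map_tnth_enum (pte_x a b)) -map_comp. Qed.

(** The entries are polynomials with integer coefficients, so every ring morphism, evaluation at a
    point included, commutes with them. *)
Lemma map_pte_x (R S : comNzRingType) (f : {rmorphism R -> S}) (a b : R) :
  [seq f x | x <- pte_x a b] = pte_x (f a) (f b).
Proof. by rewrite /= !(rmorphM, rmorphD, rmorphN, rmorph1, rmorph_nat, rmorphXn). Qed.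

Lemma map_pte_y (R S : comNzRingType) (f : {rmorphism R -> S}) (a b : R) :
  [seq f x | x <- pte_y a b] = pte_y (f a) (f b).
Proof.
rewrite !pte_yE -map_pte_x -!map_comp.
by apply: eq_map => x /=; rewrite rmorphN.
Qed.

Theorem mainTheorem6 :
  (forall n1 n2 : rat, forall r : nat, (1 <= r <= 6)%N ->
     \sum_(i < 7) tnth (pte_x n1 n2) i ^+ r
       = \sum_(i < 7) tnth (pte_y n1 n2) i ^+ r) /\
  ~ perm_eq (pte_x ('X_0 : {mpoly rat[2]}) 'X_1)
            (pte_y ('X_0 : {mpoly rat[2]}) 'X_1).
Proof.
split=> [n1 n2 r /andP[_ r_le6]|].
  (* The sign depends only on the parity of [r], so it factors out of the sum. *)
  under [RHS]eq_bigr do rewrite tnth_mktuple exprNn -signr_odd.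
  rewrite -mulr_sumr; case: (boolP (odd r)) => [r_odd|_].
    by rewrite sum_pte_x_odd // mulr0.
  by rewrite mul1r.
pose v (i : 'I_2) : rat := if i == 0 then 1 else 3.
pose ev : {rmorphism {mpoly rat[2]} -> rat} := meval v.
have evX i : ev 'X_i = v i by exact: mevalXU.
move=> /(perm_map ev).
(* Membership of -32 = -x_1 computes to false on the left and true on the right. *)
rewrite map_pte_x map_pte_y !evX pte_yE => /perm_mem/(_ (- 32)).
by vm_compute.
Qed.
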